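(* Let $g_1=v^{-4/3}g_s$ be a metric on $S^1$ with $v\in C^4(S^1)$, $v>0$, and let $\varphi\in C^4(S^1)$ with $\varphi>0$. If $g_2=\varphi^{-4/3}g_1$, then $$Q_{g_2}=\varphi^{5/3}P_{g_1}\varphi,$$ and $$P_{g_2}\psi=\varphi^{5/3}P_{g_1}(\psi\varphi)\qquad\text{for all }\psi\in C^4(S^1).$$
   Context: $S^1$ is the unit circle with angle $\theta$ and standard metric $g_s=d\theta\otimes d\theta$; functions on $S^1$ are $2\pi$-periodic functions of $\theta$. For a metric $g=d\sigma\otimes d\sigma=v^{-4/3}g_s$ with $v>0$ (so $d\sigma=v^{-2/3}d\theta$), put $\nabla_g=D_\sigma=v^{2/3}\frac{d}{d\theta}$ and $\Delta_g=D_{\sigma\sigma}=\nabla_g\nabla_g$. The $4$-scalar curvature of $g$ is $$k_g=w^3(4w_{\theta\theta}+w),\qquad w=v^{1/3},$$ the $Q$-curvature of $g$ is $$Q_g=\tfrac19v^{5/3}\big(16v_{\theta\theta\theta\theta}+40v_{\theta\theta}+9v\big),$$ and the operator $P_g$ is $$P_g(f)=\tfrac{16}{9}\Delta_g^2f+\tfrac{40}{9}\nabla_g(k_g\nabla_gf)+Q_gf,\qquad f\in C^4(S^1).$$ *)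

(* Defs.v *)
From Stdlib Require Import Reals Lra.
From Coquelicot Require Import Coquelicot.
Local Open Scope R_scope.

(** A function on the circle S^1 is a 2*PI-periodic function of the angle. *)
Definition periodic (f : R -> R) : Prop :=
  forall theta : R, f (theta + 2 * PI) = f theta.

(** [ex_derive_n f k x] only says that the total function [Derive_n f (k - 1)]
    is derivable at [x]; the orders below [k] must be required separately. *)
Definition C4_circle (f : R -> R) : Prop :=
  periodic f /\
  (forall k : nat, (k <= 4)%nat -> forall theta : R, ex_derive_n f k theta) /\
  (forall theta : R, continuous (Derive_n f 4) theta).

(** The metric [coef theta * (dtheta (x) dtheta)] on S^1.  No regularity is
    imposed here: it is carried by the conformal factors. *)
Record metric : Type := Metric {
  coef :> R -> R;
  coef_periodic : periodic coef;
  coef_pos : forall theta : R, 0 < coef theta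
}.

Lemma periodic_one : periodic (fun _ => 1).
Proof. intros theta; reflexivity. Qed.

Definition g_s : metric :=
  Metric (fun _ => 1) periodic_one (fun _ => Rlt_0_1).

(** [g' = phi^(-4/3) g]; meaningful for [phi > 0]. *)
Definition conformal (phi : R -> R) (g g' : metric) : Prop :=
  forall theta : R, g' theta = Rpower (phi theta) (- (4 / 3)) * g theta.

(** The unique positive [v] such that [g = v^(-4/3) g_s]. *)
Definition vfun (g : metric) : R -> R :=
  fun theta => Rpower (g theta) (- (3 / 4)).

Lemma conformal_vfun (g : metric) : conformal (vfun g) g_s g.
Proof.
intros theta; unfold vfun; simpl.
rewrite Rpower_mult, Rmult_1_r.
replace (- (3 / 4) * - (4 / 3)) with 1 by field.
symmetry; apply Rpower_1, coef_pos.
Qed.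

Lemma vfun_unique (v : R -> R) (g : metric) :
  (forall theta, 0 < v theta) -> conformal v g_s g ->
  forall theta, vfun g theta = v theta.
Proof.
intros Hv Hg theta; unfold vfun.
rewrite Hg; simpl; rewrite Rmult_1_r, Rpower_mult.
replace (- (4 / 3) * - (3 / 4)) with 1 by field.
apply Rpower_1, Hv.
Qed.

Lemma conformal_exists (phi : R -> R) (g : metric) :
  periodic phi -> exists g' : metric, conformal phi g g'.
Proof.
intros Hphi.
assert (Hper : periodic
          (fun theta => Rpower (phi theta) (- (4 / 3)) * g theta)).
{ intros theta; rewrite (Hphi theta), (coef_periodic g theta); reflexivity. }
assert (Hpos : forall theta,
          0 < Rpower (phi theta) (- (4 / 3)) * g theta).
{ intros theta; apply Rmult_lt_0_compat; [apply exp_pos | apply coef_pos]. }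
exists (Metric _ Hper Hpos); intros theta; reflexivity.
Qed.

(** Derivative with respect to the arclength [dsigma = v^(-2/3) dtheta]. *)
Definition nabla (g : metric) (f : R -> R) : R -> R :=
  fun theta => Rpower (vfun g theta) (2 / 3) * Derive f theta.

Definition Delta (g : metric) (f : R -> R) : R -> R := nabla g (nabla g f).

Definition scalar_curv4 (g : metric) : R -> R :=
  let w := fun theta => Rpower (vfun g theta) (1 / 3) in
  fun theta => w theta ^ 3 * (4 * Derive_n w 2 theta + w theta).

Definition Qcurv (g : metric) : R -> R :=
  let v := vfun g in
  fun theta =>
    1 / 9 * Rpower (v theta) (5 / 3) *
    (16 * Derive_n v 4 theta + 40 * Derive_n v 2 theta + 9 * v theta).

Definition Pop (g : metric) (f : R -> R) : R -> R :=
  fun theta =>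
    16 / 9 * Delta g (Delta g f) theta
    + 40 / 9 * nabla g (fun t => scalar_curv4 g t * nabla g f t) theta
    + Qcurv g theta * f theta.

(* Main.v *)
Require Import Defs.
From Stdlib Require Import Reals Lia FunctionalExtensionality.
From Coquelicot Require Import Coquelicot.
Local Open Scope R_scope.

(** For [g = v^(-4/3) g_s] the operator factors through the flat one:
    [P_g f = 1/9 v^(5/3) L (v f)] with [L u = 16 u'''' + 40 u'' + 9 u], while
    [Q_g = 1/9 v^(5/3) L v].  Since the conformal factor of [g2] is [v phi],
    both identities follow by comparing [v (psi phi)] with [(v phi) psi].
    The factorization is a polynomial identity in the derivatives of
    [w = v^(1/3)] and [f]. *)

(** * Iterated derivability and its closure properties *)

(** The derivatives are existential witnesses: products and powers go through by induction on [n],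
    and destructing the case 4 yields the named derivatives used in the polynomial computations. *)
Fixpoint derivable_n (n : nat) (f : R -> R) : Prop :=
  match n with
  | O => True
  | S m => exists f' : R -> R,
      (forall x : R, is_derive f x (f' x)) /\ derivable_n m f'
  end.

Lemma derivable_n_weaken (n : nat) (f : R -> R) :
  derivable_n (S n) f -> derivable_n n f.
Proof.
revert f; induction n as [|n IH]; intros f; [easy|].
intros [f' [Hf Hf']]; exists f'; split; [exact Hf | exact (IH f' Hf')].
Qed.

Lemma derivable_n_scal (n : nat) (c : R) (f : R -> R) :
  derivable_n n f -> derivable_n n (fun x => c * f x).
Proof.
revert f; induction n as [|n IH]; intros f; [easy|].
intros [f' [Hf Hf']]; exists (fun x => c * f' x); split; [|exact (IH f' Hf')].
intros x; apply (is_derive_scal f x c (f' x)), Hf.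
Qed.

Lemma derivable_n_plus (n : nat) (f g : R -> R) :
  derivable_n n f -> derivable_n n g -> derivable_n n (fun x => f x + g x).
Proof.
revert f g; induction n as [|n IH]; intros f g; [easy|].
intros [f' [Hf Hf']] [g' [Hg Hg']].
exists (fun x => f' x + g' x); split; [|exact (IH f' g' Hf' Hg')].
intros x; exact (is_derive_plus f g x _ _ (Hf x) (Hg x)).
Qed.

(** Both terms of [f' g + f g'] contain an undifferentiated factor, which has to be weakened to
    order [n] before the induction hypothesis applies. *)
Lemma derivable_n_mult (n : nat) (f g : R -> R) :
  derivable_n n f -> derivable_n n g -> derivable_n n (fun x => f x * g x).
Proof.
revert f g; induction n as [|n IH]; intros f g; [easy|].
intros Df Dg.
pose proof (derivable_n_weaken _ _ Df) as Wf.
pose proof (derivable_n_weaken _ _ Dg) as Wg.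
destruct Df as [f' [Hf Hf']], Dg as [g' [Hg Hg']].
exists (fun x => f' x * g x + f x * g' x); split.
- intros x; exact (is_derive_mult f g x _ _ (Hf x) (Hg x) Rmult_comm).
- apply derivable_n_plus; apply IH; assumption.
Qed.

Lemma is_derive_Rpower (f : R -> R) (a x l : R) :
  0 < f x -> is_derive f x l ->
  is_derive (fun t => Rpower (f t) a) x (a * (l * Rpower (f x) (a - 1))).
Proof.
intros Hpos Hf.
replace (a * (l * Rpower (f x) (a - 1)))
  with (l * (a * Rpower (f x) (a - 1))) by ring.
apply (is_derive_comp (fun y => Rpower y a) f x); [|exact Hf].
apply is_derive_Reals, derivable_pt_lim_power, Hpos.
Qed.

Lemma derivable_n_Rpower (n : nat) (f : R -> R) (a : R) :
  (forall x : R, 0 < f x) -> derivable_n n f ->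
  derivable_n n (fun x => Rpower (f x) a).
Proof.
(* The exponent stays general because each differentiation lowers it by one. *)
intros Hpos; revert a; induction n as [|n IH]; intros a; [easy|].
intros Df; pose proof (derivable_n_weaken _ _ Df) as Wf.
destruct Df as [f' [Hf Hf']].
exists (fun x => a * (f' x * Rpower (f x) (a - 1))); split.
- intros x; apply is_derive_Rpower; [apply Hpos | apply Hf].
- apply derivable_n_scal, derivable_n_mult; [exact Hf' | exact (IH _ Wf)].
Qed.

Lemma C4_circle_derivable_n (f : R -> R) : C4_circle f -> derivable_n 4 f.
Proof.
intros [_ [Hf _]].
assert (D : forall k, (k < 4)%nat -> forall x,
          is_derive (Derive_n f k) x (Derive_n f (S k) x)).
(* Index shift: [ex_derive_n f (S k) x] is derivability of [Derive_n f k] at [x]. *)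
{ intros k Hk x; apply Derive_correct, (Hf (S k)); lia. }
exists (Derive_n f 1); split; [apply (D 0%nat); lia|].
exists (Derive_n f 2); split; [apply (D 1%nat); lia|].
exists (Derive_n f 3); split; [apply (D 2%nat); lia|].
exists (Derive_n f 4); split; [apply (D 3%nat); lia | exact I].
Qed.

(** * Iterated derivatives and the flat operator *)

Lemma Derive_fun (f f' : R -> R) :
  (forall x : R, is_derive f x (f' x)) -> Derive f = f'.
Proof.
(* An equality of functions, unlike a pointwise one, can be rewritten inside nested [Derive]. *)
intros Hf; apply functional_extensionality; intros x.
apply is_derive_unique, Hf.
Qed.

Lemma Rpower_third_pow (x : R) (n : nat) :
  Rpower x (1 / 3) ^ n = Rpower x (INR n / 3).
Proof.
rewrite <- Rpower_pow by apply exp_pos.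
rewrite Rpower_mult; f_equal; field.
Qed.

(** This is 9 times the operator P of the round metric [g_s], whose curvatures k and Q both equal
    1. *)
Definition flat_op (u : R -> R) (theta : R) : R :=
  16 * Derive_n u 4 theta + 40 * Derive_n u 2 theta + 9 * u theta.

Lemma flat_op_derivatives (u u1 u2 u3 u4 : R -> R) (theta : R) :
  (forall x : R, is_derive u x (u1 x)) ->
  (forall x : R, is_derive u1 x (u2 x)) ->
  (forall x : R, is_derive u2 x (u3 x)) ->
  (forall x : R, is_derive u3 x (u4 x)) ->
  flat_op u theta = 16 * u4 theta + 40 * u2 theta + 9 * u theta.
Proof.
intros H H1 H2 H3; unfold flat_op.
change (Derive_n u 4 theta) with (Derive (Derive (Derive (Derive u))) theta).
change (Derive_n u 2 theta) with (Derive (Derive u) theta).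
rewrite (Derive_fun u u1 H), (Derive_fun u1 u2 H1), (Derive_fun u2 u3 H2),
  (Derive_fun u3 u4 H3).
reflexivity.
Qed.

(* [auto_derive] leaves [Derive] applied to eta-expanded functions. *)
Ltac derive_known :=
  let x := fresh "x" in
  intros x; auto_derive;
  [ repeat split; eexists; eauto
  | repeat match goal with
      H : forall y : R, is_derive ?f y _ |- _ =>
        rewrite ?(is_derive_unique (fun y : R => f y) x _ (H x)); clear H
    end; ring ].

(** * Curvatures and operators as polynomials in the cube root of v *)

Section CubeRootCoordinates.

Variables w w1 w2 w3 w4 : R -> R.
Hypothesis Hw : forall x : R, is_derive w x (w1 x).
Hypothesis Hw1 : forall x : R, is_derive w1 x (w2 x).
Hypothesis Hw2 : forall x : R, is_derive w2 x (w3 x).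
Hypothesis Hw3 : forall x : R, is_derive w3 x (w4 x).

Variables f f1 f2 f3 f4 : R -> R.
Hypothesis Hf : forall x : R, is_derive f x (f1 x).
Hypothesis Hf1 : forall x : R, is_derive f1 x (f2 x).
Hypothesis Hf2 : forall x : R, is_derive f2 x (f3 x).
Hypothesis Hf3 : forall x : R, is_derive f3 x (f4 x).

(** [ck] is the k-th derivative of [v = w^3]. *)
Let c0 x := w x ^ 3.
Let c1 x := 3 * w x ^ 2 * w1 x.
Let c2 x := 6 * w x * w1 x ^ 2 + 3 * w x ^ 2 * w2 x.
Let c3 x := 6 * w1 x ^ 3 + 18 * w x * w1 x * w2 x + 3 * w x ^ 2 * w3 x.
Let c4 x := 36 * w1 x ^ 2 * w2 x + 18 * w x * w2 x ^ 2
            + 24 * w x * w1 x * w3 x + 3 * w x ^ 2 * w4 x.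

(** Leibniz's rule for [w^3 f]: the weights 1, 4, 6, 4, 1 and 1, 2, 1 are binomial coefficients. *)
Lemma flat_op_cube_mult (x : R) :
  flat_op (fun t => w t ^ 3 * f t) x =
  16 * (c4 x * f x + 4 * c3 x * f1 x + 6 * c2 x * f2 x + 4 * c1 x * f3 x
        + c0 x * f4 x)
  + 40 * (c2 x * f x + 2 * c1 x * f1 x + c0 x * f2 x) + 9 * (c0 x * f x).
Proof.
apply (flat_op_derivatives (fun t => w t ^ 3 * f t)
  (fun t => c1 t * f t + c0 t * f1 t)
  (fun t => c2 t * f t + 2 * c1 t * f1 t + c0 t * f2 t)
  (fun t => c3 t * f t + 3 * c2 t * f1 t + 3 * c1 t * f2 t + c0 t * f3 t)
  (fun t => c4 t * f t + 4 * c3 t * f1 t + 6 * c2 t * f2 t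
            + 4 * c1 t * f3 t + c0 t * f4 t));
  unfold c0, c1, c2, c3, c4; derive_known.
Qed.

Lemma flat_op_cube (x : R) :
  flat_op (fun t => w t ^ 3) x = 16 * c4 x + 40 * c2 x + 9 * c0 x.
Proof.
apply (flat_op_derivatives (fun t => w t ^ 3) c1 c2 c3 c4);
  unfold c1, c2, c3, c4; derive_known.
Qed.

Variable g : metric.
Hypothesis w_def : w = fun t => Rpower (vfun g t) (1 / 3).

Lemma vfun_cube : vfun g = fun t => w t ^ 3.
Proof.
apply functional_extensionality; intros t.
rewrite w_def, Rpower_third_pow.
replace (INR 3 / 3) with 1 by (simpl; field).
symmetry; apply Rpower_1, exp_pos.
Qed.

Lemma nabla_cube_root (h h' : R -> R) :
  (forall x : R, is_derive h x (h' x)) ->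
  nabla g h = fun x => w x ^ 2 * h' x.
Proof.
intros Hh; apply functional_extensionality; intros x.
unfold nabla; rewrite (Derive_fun h h' Hh).
(* [INR 2] and the literal 2 both reduce to [1 + 1], so the exponents agree by conversion. *)
rewrite w_def, Rpower_third_pow; reflexivity.
Qed.

Lemma scalar_curv4_cube_root :
  scalar_curv4 g = fun x => w x ^ 3 * (4 * w2 x + w x).
Proof.
apply functional_extensionality; intros x.
unfold scalar_curv4; rewrite <- w_def.
change (Derive_n w 2 x) with (Derive (Derive w) x).
rewrite (Derive_fun w w1 Hw), (Derive_fun w1 w2 Hw1), (equal_f w_def x).
reflexivity.
Qed.

Lemma Qcurv_cube_root (x : R) :
  Qcurv g x = 1 / 9 * w x ^ 5 * flat_op (fun t => w t ^ 3) x.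
Proof.
rewrite <- vfun_cube, w_def, Rpower_third_pow.
replace (INR 5) with 5 by (simpl; ring).
reflexivity.
Qed.

Lemma Delta2_cube_root :
  Defs.Delta g (Defs.Delta g f) = fun x =>
    w x ^ 2 * (w x ^ 6 * f4 x + 12 * w x ^ 5 * w1 x * f3 x
      + (36 * w x ^ 4 * w1 x ^ 2 + 8 * w x ^ 5 * w2 x) * f2 x
      + (24 * w x ^ 3 * w1 x ^ 3 + 22 * w x ^ 4 * w1 x * w2 x
         + 2 * w x ^ 5 * w3 x) * f1 x).
Proof.
unfold Defs.Delta.
rewrite (nabla_cube_root f f1 Hf).
(* Four applications of [nabla]: each function differentiated is [w^2] times the derivative found in
   the previous step. *)
rewrite (nabla_cube_root (fun x => w x ^ 2 * f1 x)
           (fun x => w x ^ 2 * f2 x + 2 * w x * w1 x * f1 x))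
  by derive_known.
rewrite (nabla_cube_root
           (fun x => w x ^ 2 * (w x ^ 2 * f2 x + 2 * w x * w1 x * f1 x))
           (fun x => w x ^ 4 * f3 x + 6 * w x ^ 3 * w1 x * f2 x
              + (6 * w x ^ 2 * w1 x ^ 2 + 2 * w x ^ 3 * w2 x) * f1 x))
  by derive_known.
apply nabla_cube_root; derive_known.
Qed.

Lemma nabla_curv_nabla_cube_root :
  nabla g (fun t => scalar_curv4 g t * nabla g f t) = fun x =>
    w x ^ 2 * (w x ^ 5 * (4 * w2 x + w x) * f2 x
      + (20 * w x ^ 4 * w1 x * w2 x + 4 * w x ^ 5 * w3 x
         + 6 * w x ^ 5 * w1 x) * f1 x).
Proof.
rewrite (nabla_cube_root f f1 Hf), scalar_curv4_cube_root.
apply nabla_cube_root; derive_known.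
Qed.

(** Compare coefficients of the derivatives of [f]. Those of [f3] and [f4] come from the squared
    Laplacian alone; in those of [f1] and [f2] the k-term completes the [w2] and [w3] contributions,
    for instance 128 + 160 = 16 * 6 * 3 for [w^7 w2 f2], and yields the part coming from 40 u''. The
    coefficient of [f] is Q itself. *)
Lemma Pop_cube_root (x : R) :
  Pop g f x = 1 / 9 * w x ^ 5 * flat_op (fun t => w t ^ 3 * f t) x.
Proof.
unfold Pop.
rewrite Delta2_cube_root, nabla_curv_nabla_cube_root, Qcurv_cube_root.
rewrite flat_op_cube, flat_op_cube_mult.
unfold c0, c1, c2, c3, c4; field.
Qed.

End CubeRootCoordinates.

(** * Factorization through the flat operator and conformal change *)

Lemma Pop_flat_op (g : metric) (f : R -> R) (theta : R) :
  derivable_n 4 (vfun g) -> derivable_n 4 f ->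
  Pop g f theta =
  1 / 9 * Rpower (vfun g theta) (5 / 3) *
  flat_op (fun t => vfun g t * f t) theta.
Proof.
intros Dv Df.
pose (w := fun t => Rpower (vfun g t) (1 / 3)).
assert (Dw : derivable_n 4 w).
{ apply derivable_n_Rpower; [intros x; apply exp_pos | exact Dv]. }
destruct Dw as (w1 & Hw & w2 & Hw1 & w3 & Hw2 & w4 & Hw3 & _).
destruct Df as (f1 & Hf & f2 & Hf1 & f3 & Hf2 & f4 & Hf3 & _).
rewrite (Pop_cube_root w w1 w2 w3 w4 Hw Hw1 Hw2 Hw3
           f f1 f2 f3 f4 Hf Hf1 Hf2 Hf3 g eq_refl).
rewrite (vfun_cube w g eq_refl).
(* With [vfun g] rewritten as [w^3], the prefactor v^(5/3) has become (w^3)^(5/3). *)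
replace (Rpower (w theta ^ 3) (5 / 3)) with (w theta ^ 5); [reflexivity|].
rewrite <- !Rpower_pow by apply exp_pos.
rewrite Rpower_mult; f_equal; simpl; field.
Qed.

(** The powers -4/3 of the two factors multiply, so [v phi] is a positive factor from [g_s] to [g2],
    and such a factor is unique. *)
Lemma vfun_conformal (v phi : R -> R) (g1 g2 : metric) :
  (forall theta, 0 < v theta) -> (forall theta, 0 < phi theta) ->
  conformal v g_s g1 -> conformal phi g1 g2 ->
  vfun g2 = fun theta => v theta * phi theta.
Proof.
intros Hv Hphi H1 H2; apply functional_extensionality.
apply vfun_unique.
- intros t; apply Rmult_lt_0_compat; [apply Hv | apply Hphi].
- intros t; rewrite H2, H1, <- Rpower_mult_distr by auto; ring.
Qed.

Theorem proposition3 (v phi : R -> R) (g1 g2 : metric)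
  (hv : C4_circle v) (hv_pos : forall theta : R, 0 < v theta)
  (hphi : C4_circle phi) (hphi_pos : forall theta : R, 0 < phi theta)
  (hg1 : conformal v g_s g1)
  (hg2 : conformal phi g1 g2) :
  (forall theta : R,
     Qcurv g2 theta = Rpower (phi theta) (5 / 3) * Pop g1 phi theta) /\
  (forall psi : R -> R, C4_circle psi ->
     forall theta : R,
       Pop g2 psi theta =
       Rpower (phi theta) (5 / 3) *
       Pop g1 (fun t => psi t * phi t) theta).
Proof.
pose proof (C4_circle_derivable_n v hv) as Dv.
pose proof (C4_circle_derivable_n phi hphi) as Dphi.
assert (V1 : vfun g1 = v).
{ apply functional_extensionality; exact (vfun_unique v g1 hv_pos hg1). }
pose proof (vfun_conformal v phi g1 g2 hv_pos hphi_pos hg1 hg2) as V2.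
split.
- intros theta.
  rewrite Pop_flat_op by (rewrite ?V1; assumption).
  (* Q is the flat operator applied to [vfun g2], up to its prefactor; that function is [v phi], the
     very argument on the other side. *)
  change (Qcurv g2 theta) with
    (1 / 9 * Rpower (vfun g2 theta) (5 / 3) * flat_op (vfun g2) theta).
  rewrite V1, V2, <- Rpower_mult_distr by auto; ring.
- intros psi hpsi theta.
  pose proof (C4_circle_derivable_n psi hpsi) as Dpsi.
  (* The factorization for [g2] requires four derivatives of [v phi], the one for [g1] four of
     [psi phi]; both are products. *)
  rewrite !Pop_flat_op
    by (rewrite ?V1, ?V2; auto using derivable_n_mult).
  rewrite V1, V2, <- Rpower_mult_distr by auto.
  replace (fun t => v t * (psi t * phi t))
    with (fun t => v t * phi t * psi t)
    by (apply functional_extensionality; intros t; ring).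
  ring.
Qed.
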